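(* Let $X\subset\mathbb{S}^3$ be an antipodal spherical $\{10,4,2\}$-design with $|X|=24$. Then there exists an orthogonal transformation $\sigma\in O(\mathbb{R}^4)$ such that $X=\sigma\big(\tfrac{1}{\sqrt{2}}\mathbf{D}_4\big)$.
   Context: $\mathbb{S}^{d-1}$ is the unit sphere in $\mathbb{R}^d$ with the standard inner product $\langle\cdot,\cdot\rangle$. $\mathrm{Harm}_\ell(\mathbb{R}^d)$ denotes the real vector space of homogeneous polynomials of degree exactly $\ell$ in $d$ variables annihilated by the Laplacian $\sum_{j}\partial^2/\partial x_j^2$. For $T\subset\mathbb{N}$, a nonempty finite set $X\subset\mathbb{S}^{d-1}$ is a spherical $T$-design if $\sum_{x\in X}P(x)=0$ for all $P\in\mathrm{Harm}_\ell(\mathbb{R}^d)$ and all $\ell\in T$. $X$ is antipodal if $-X=X$. $\mathbf{D}_4\subset\mathbb{R}^4$ is the $D_4$ root system: the 24 vectors obtained as all permutations of $(\pm1,\pm1,0,0)$; $\tfrac{1}{\sqrt2}\mathbf{D}_4=\{\tfrac{1}{\sqrt2}x: x\in\mathbf{D}_4\}$. $O(\mathbb{R}^4)$ is the group of linear maps preserving the inner product. *)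

(* Defs.v *)
From mathcomp Require Export all_boot all_order all_algebra fingroup perm.
From mathcomp Require Export finmap mpoly.
From mathcomp Require Export reals.

Set Implicit Arguments.
Unset Strict Implicit.
Unset Printing Implicit Defensive.

Import GRing.Theory Num.Theory.
Local Open Scope ring_scope.
Local Open Scope fset_scope.

Section SphericalDesigns.
Variables (R : realType) (d : nat).
Implicit Types (x y : 'rV[R]_d) (P : {mpoly R[d]}) (X : {fset 'rV[R]_d}).

Definition inner x y : R := \sum_(i < d) x 0 i * y 0 i.

(* The unit sphere S^(d-1). *)
Definition sphere : {pred 'rV[R]_d} := [pred x | inner x x == 1].

Definition laplacian P : {mpoly R[d]} := \sum_(j < d) P^`M(j)^`M(j).

(* [l.-homog] contains the zero polynomial, so this is a vector space. *)
Definition Harm (l : nat) : {pred {mpoly R[d]}} :=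
  [pred P | (P \is l.-homog) && (laplacian P == 0)].

Definition evalv P x : R := P.@[fun i => x 0 i].

Definition spherical_design (T : {pred nat}) X : Prop :=
  [/\ X != fset0,
      {subset X <= sphere} &
      forall l, l \in T -> forall P, P \in Harm l ->
        \sum_(x <- X) evalv P x = 0].

Definition antipodal X : Prop := [fset - x | x in X] = X.

Definition orthogonal_map (s : {linear 'rV[R]_d -> 'rV[R]_d}) : Prop :=
  forall x y, inner (s x) (s y) = inner x y.

End SphericalDesigns.

(* The vector ((-1)^a, (-1)^b, 0, 0). *)
Definition D4_base (R : realType) (a b : bool) : 'rV[R]_4 :=
  \row_(i < 4) nth 0 [:: (-1) ^+ a; (-1) ^+ b; 0; 0] i.

Definition D4 (R : realType) : {fset 'rV[R]_4} :=
  [fset col_perm p.1 (D4_base R p.2.1 p.2.2) | p in {: 'S_4 * (bool * bool)}].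

Definition scaled_D4 (R : realType) : {fset 'rV[R]_4} :=
  [fset (Num.sqrt 2)^-1 *: x | x in D4 R].

(* Main.v *)
Require Import Defs.
From mathcomp Require Import ring lra.

(** For [|y| = 1] the polynomial [|x|^n U_n(<x,y>/|x|)], with [U_n] the Chebyshev
    polynomial of the second kind, is harmonic on R^4. Summing the nonnegative
    polynomial
      [U_10 + 2 U_4 + 4 U_2 + 3 = 64 t^2 (t^2 - 1/4)^2 (16 t^4 - 28 t^2 + 13)]
    at [t = <x,y>] over the design gives 72, which the two points [x = y] and
    [x = -y] already contribute; hence all other inner products are [0] or
    [1/2] or [-1/2]. Degrees 2 and 4 fix the sums of [<w,x>^2], [<w,x>^4] and, for
    [x] orthogonal to [y], of [<w,x>^2 <w,y>^2]; they force [<w,x>^2 = <w,y>^2] for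
    every [w] in [X] other than [x], [-x], [y], [-y]. By averaging, [X] contains an
    orthonormal frame, all other points then have coordinates [1/2] or [-1/2] in
    it, and a rotation by 45 degrees in two coordinate planes gives D_4. *)

Set Implicit Arguments.
Unset Strict Implicit.
Unset Printing Implicit Defensive.

Import Order.TTheory GRing.Theory Num.Theory.
Local Open Scope ring_scope.

(** * First-order operators and the Laplacian of a product *)

Section VectorFields.
Variables (R : realType) (d : nat).
Implicit Types (P Q : {mpoly R[d]}) (v : 'I_d -> {mpoly R[d]}) (y : 'rV[R]_d).

Lemma mpolyC_nat n : n%:R%:MP = n%:R :> {mpoly R[d]}.
Proof. exact: rmorph_nat. Qed.

(** Directional derivatives, the Euler operator and the gradient pairing in [laplacianM] are all of
    this form, so one Leibniz rule serves them all. *)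
Definition vfield v P : {mpoly R[d]} := \sum_i v i * P^`M(i).

Definition linform y : {mpoly R[d]} := \sum_i (y 0 i)%:MP * 'X_i.

Definition sqnorm : {mpoly R[d]} := \sum_i 'X_i * 'X_i.

Definition yfield y := vfield (fun i => (y 0 i)%:MP).
Definition euler := vfield (fun i => 'X_i).

Lemma vfieldB v P Q : vfield v (P - Q) = vfield v P - vfield v Q.
Proof.
by rewrite /vfield -sumrB; apply: eq_bigr => i _; rewrite mderivB mulrBr.
Qed.

Lemma vfieldM v P Q : vfield v (P * Q) = vfield v P * Q + P * vfield v Q.
Proof.
rewrite /vfield mulr_suml mulr_sumr -big_split; apply: eq_bigr => i _ /=.
by rewrite mderivM; ring.
Qed.

Lemma vfieldC v (c : R) : vfield v c%:MP = 0.
Proof. by rewrite /vfield big1 // => i _; rewrite mderivC mulr0. Qed.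

Lemma mderivXU (i j : 'I_d) : ('X_j)^`M(i) = (i == j)%:R :> {mpoly R[d]}.
Proof.
rewrite mderivX mnm1E eq_sym; case: eqP => [->|_]; last by rewrite scale0r.
by rewrite scale1r -{1}[U_(j)%MM]addm0 addmC addmK mpolyX0.
Qed.

Lemma sum_kronecker (A : pzRingType) (F : 'I_d -> A) i :
  \sum_j F j * (i == j)%:R = F i.
Proof.
rewrite (bigD1 i) //= eqxx mulr1 big1 ?addr0 // => j ji.
by rewrite eq_sym (negbTE ji) mulr0.
Qed.

Lemma mderiv_linform y i : (linform y)^`M(i) = (y 0 i)%:MP.
Proof.
rewrite /linform raddf_sum -[RHS](sum_kronecker (fun j => (y 0 j)%:MP)) /=.
by apply: eq_bigr => j _; rewrite mderiv_mulC mderivXU.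
Qed.

Lemma mderiv_sqnorm i : sqnorm^`M(i) = 2%:MP * 'X_i.
Proof.
rewrite /sqnorm raddf_sum -[RHS](sum_kronecker (fun j => 2%:MP * 'X_j)) /=.
apply: eq_bigr => j _; rewrite mderivM mderivXU.
by rewrite !mpolyC_nat; ring.
Qed.

Lemma yfield_linform y : yfield y (linform y) = (inner y y)%:MP.
Proof.
rewrite /yfield /vfield /inner rmorph_sum; apply: eq_bigr => i _.
by rewrite mderiv_linform rmorphM.
Qed.

Lemma yfield_sqnorm y : yfield y sqnorm = 2%:MP * linform y.
Proof.
rewrite /yfield /vfield /linform mulr_sumr; apply: eq_bigr => i _.
by rewrite mderiv_sqnorm; ring.
Qed.

Lemma euler_linform y : euler (linform y) = linform y.
Proof.
rewrite /euler /vfield /linform; apply: eq_bigr => i _.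
by rewrite mderiv_linform; ring.
Qed.

Lemma euler_sqnorm : euler sqnorm = 2%:MP * sqnorm.
Proof.
rewrite /euler /vfield /sqnorm mulr_sumr; apply: eq_bigr => i _.
by rewrite mderiv_sqnorm; ring.
Qed.

Lemma laplacianB P Q : laplacian (P - Q) = laplacian P - laplacian Q.
Proof.
by rewrite /laplacian -sumrB; apply: eq_bigr => i _; rewrite !mderivB.
Qed.

Lemma laplacian_mulC (c : R) P : laplacian (c%:MP * P) = c%:MP * laplacian P.
Proof.
by rewrite /laplacian mulr_sumr; apply: eq_bigr => i _; rewrite !mderiv_mulC.
Qed.

Lemma laplacianM P Q : laplacian (P * Q) =
  laplacian P * Q + 2%:MP * vfield (fun i => P^`M(i)) Q + P * laplacian Q.
Proof.
rewrite /laplacian /vfield mulr_suml !mulr_sumr -!big_split.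
apply: eq_bigr => i _ /=; rewrite mderivM mderivD !mderivM.
by rewrite !mpolyC_nat; ring.
Qed.

Lemma laplacian_linformM y P :
  laplacian (linform y * P) = 2%:MP * yfield y P + linform y * laplacian P.
Proof.
rewrite laplacianM {1}/laplacian big1 ?mul0r ?add0r; last first.
  by move=> i _; rewrite mderiv_linform mderivC.
by congr (_ * _ + _); apply: eq_bigr => i _; rewrite mderiv_linform.
Qed.

(** The Laplacian of [|x|^2] is [2d], and its gradient [2x] turns the cross term into [4] times the
    Euler operator. *)
Lemma laplacian_sqnormM P : laplacian (sqnorm * P) =
  (2 * d)%:R * P + 4%:MP * euler P + sqnorm * laplacian P.
Proof.
rewrite laplacianM; congr (_ * _ + _ + _).
  rewrite /laplacian (eq_bigr (fun=> 2%:MP)); last first.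
    by move=> i _; rewrite mderiv_sqnorm mderiv_mulC mderivXU eqxx mulr1.
  by rewrite sumr_const card_ord mpolyC_nat mulrnA.
rewrite /euler /vfield !mulr_sumr; apply: eq_bigr => i _.
rewrite mderiv_sqnorm mulrA mulrA -rmorphM mulrA; congr (_%:MP * _ * _); ring.
Qed.

Lemma linform_homog y : linform y \is 1.-homog.
Proof.
apply: rpred_sum => i _; rewrite mul_mpolyC; apply: rpredZ.
by rewrite dhomogX /= mdeg1.
Qed.

Lemma sqnorm_homog : sqnorm \is 2.-homog.
Proof.
apply: rpred_sum => i _; apply: (@dhomogM _ _ _ 1%N _ 1%N);
  by rewrite dhomogX /= mdeg1.
Qed.

End VectorFields.

(** * Zonal harmonics on R^4 *)

Section Zonal.
Variable (R : realType).
Implicit Types (x y : 'rV[R]_4).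

(* [|x|^n |y|^n U_n(<x,y> / (|x| |y|))] as a polynomial in [x]. *)
Fixpoint zonal y (n : nat) : {mpoly R[4]} :=
  match n with
  | 0 => 1
  | m.+1 => match m with
    | 0 => 2%:MP * linform y
    | k.+1 => 2%:MP * (linform y * zonal y m)
              - (inner y y)%:MP * (sqnorm R 4 * zonal y k)
    end
  end.

Arguments zonal : simpl never.

Lemma zonal0 y : zonal y 0 = 1%:MP.
Proof. by rewrite mpolyC1. Qed.

Lemma zonal1 y : zonal y 1 = 2%:MP * linform y.
Proof. by []. Qed.

Lemma zonalSS y n : zonal y n.+2 =
  2%:MP * (linform y * zonal y n.+1)
  - (inner y y)%:MP * (sqnorm R 4 * zonal y n).
Proof. by []. Qed.

Lemma nat_ind2 (T : nat -> Prop) :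
  T 0%N -> T 1%N -> (forall n, T n -> T n.+1 -> T n.+2) -> forall n, T n.
Proof.
move=> T0 T1 TS n; suff: T n /\ T n.+1 by case.
by elim: n => // n [? ?]; split=> //; apply: TS.
Qed.

Lemma zonal_homog y n : zonal y n \is n.-homog.
Proof.
elim/nat_ind2: n => [||n h0 h1]; first exact: dhomog1.
  by rewrite zonal1 mul_mpolyC; apply/rpredZ/linform_homog.
rewrite zonalSS !mul_mpolyC; apply: rpredB; apply: rpredZ.
  exact: (dhomogM (linform_homog y) h1).
exact: (dhomogM (sqnorm_homog R 4) h0).
Qed.

Lemma euler_zonal y n : euler (zonal y n) = n%:R * zonal y n.
Proof.
elim/nat_ind2: n => [||n h0 h1].
- by rewrite zonal0 /euler vfieldC mul0r.
- by rewrite zonal1 /euler vfieldM vfieldC -/(euler _) euler_linform; ring.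
rewrite zonalSS /euler vfieldB !vfieldM !vfieldC -!/(euler _) h0 h1.
rewrite euler_linform euler_sqnorm !mpolyC_nat.
by ring.
Qed.

Lemma yfield_zonalSS y n : yfield y (zonal y n.+2) =
  2%:R * ((inner y y)%:MP * zonal y n.+1 + linform y * yfield y (zonal y n.+1))
  - (inner y y)%:MP * (2%:R * linform y * zonal y n
                       + sqnorm R 4 * yfield y (zonal y n)).
Proof.
rewrite zonalSS /yfield vfieldB !vfieldM !vfieldC -!/(yfield _ _).
by rewrite yfield_linform yfield_sqnorm !mpolyC_nat; ring.
Qed.

(** Differentiating along [y] lowers the degree by one; this is what makes the Laplacian of the
    recursion computable. Both sides obey the same two-step recursion. *)
Lemma yfield_zonal y n :
  yfield y (zonal y n.+1) = (n.+2)%:R * (inner y y)%:MP * zonal y n.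
Proof.
have h0 : yfield y (zonal y 0) = 0 by rewrite zonal0 /yfield vfieldC.
have h1 : yfield y (zonal y 1) = 2%:R * (inner y y)%:MP * zonal y 0.
  rewrite zonal1 zonal0 /yfield vfieldM vfieldC -/(yfield _ _) yfield_linform.
  by rewrite mpolyC1 mpolyC_nat; ring.
elim/nat_ind2: n => [//||n hn hn1]; rewrite yfield_zonalSS.
  by rewrite h0 h1 zonal1 zonal0 mpolyC1 mpolyC_nat; ring.
by rewrite hn hn1 !zonalSS mpolyC_nat; ring.
Qed.

(** In the step, [2 * 2 * (n+2) |y|^2] from the derivative along [y] cancels [(8 + 4n) |y|^2] from
    the factor [sqnorm]; the [8] is [2d], so this is where dimension four enters. *)
Lemma laplacian_zonal y n : laplacian (zonal y n) = 0.
Proof.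
have L1 : laplacian 1 = 0 :> {mpoly R[4]}.
  by rewrite /laplacian big1 // => i _; rewrite -mpolyC1 !mderivC.
elim/nat_ind2: n => [//||n h0 h1].
  rewrite zonal1 laplacian_mulC -[linform y]mulr1 laplacian_linformM L1.
  by rewrite /yfield -mpolyC1 vfieldC !mulr0 addr0 mulr0.
rewrite zonalSS laplacianB !laplacian_mulC laplacian_linformM h1.
rewrite laplacian_sqnormM h0 euler_zonal yfield_zonal.
by rewrite !mpolyC_nat; ring.
Qed.

Lemma zonal_harm y n : zonal y n \in Harm n.
Proof. by rewrite inE zonal_homog laplacian_zonal eqxx. Qed.

Lemma evalv_linform y x : evalv (linform y) x = inner x y.
Proof.
rewrite /evalv /linform raddf_sum; apply: eq_bigr => i _ /=.
by rewrite mevalM mevalC mevalXU mulrC.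
Qed.

Lemma evalv_sqnorm x : evalv (sqnorm R 4) x = inner x x.
Proof.
rewrite /evalv /sqnorm raddf_sum; apply: eq_bigr => i _ /=.
by rewrite mevalM mevalXU.
Qed.

Lemma evalv_zonalSS y n x : evalv (zonal y n.+2) x =
  2 * inner x y * evalv (zonal y n.+1) x
  - inner y y * inner x x * evalv (zonal y n) x.
Proof.
rewrite zonalSS /evalv mevalB !mevalM !mevalC -!/(evalv _ _).
by rewrite evalv_linform evalv_sqnorm !mulrA.
Qed.

Lemma evalv_zonal0 y x : evalv (zonal y 0) x = 1.
Proof. exact: meval1. Qed.

Lemma evalv_zonal1 y x : evalv (zonal y 1) x = 2 * inner x y.
Proof. by rewrite zonal1 /evalv mevalM mevalC -/(evalv _ _) evalv_linform. Qed.

End Zonal.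

(** * Inner product algebra and two summation principles *)

Section Inner.
Variables (R : realType) (d : nat).
Implicit Types x y z : 'rV[R]_d.

Lemma innerC x y : inner x y = inner y x.
Proof. by apply: eq_bigr => i _; rewrite mulrC. Qed.

Lemma innerDl x y z : inner (x + y) z = inner x z + inner y z.
Proof. by rewrite -big_split; apply: eq_bigr => i _; rewrite mxE mulrDl. Qed.

Lemma innerNl x y : inner (- x) y = - inner x y.
Proof. by rewrite -sumrN; apply: eq_bigr => i _; rewrite mxE mulNr. Qed.

Lemma innerZl c x y : inner (c *: x) y = c * inner x y.
Proof. by rewrite mulr_sumr; apply: eq_bigr => i _; rewrite mxE mulrA. Qed.

Lemma innerDr x y z : inner x (y + z) = inner x y + inner x z.
Proof. by rewrite innerC innerDl !(innerC x). Qed.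

Lemma innerNr x y : inner x (- y) = - inner x y.
Proof. by rewrite innerC innerNl innerC. Qed.

Lemma innerZr c x y : inner x (c *: y) = c * inner x y.
Proof. by rewrite innerC innerZl innerC. Qed.

Definition innerE :=
  (innerDl, innerDr, innerNl, innerNr, innerZl, innerZr).

Lemma inner_mulmx x y : inner x y = (x *m y^T) 0 0.
Proof. by rewrite mxE; apply: eq_bigr => i _; rewrite mxE. Qed.

End Inner.

(** Removing the share of [s] from the total leaves a zero sum of nonnegative terms. *)
Lemma sum_gap (R : realDomainType) (T : choiceType) (X : {fset T})
    (F : T -> R) (s : seq T) w :
  (forall x, 0 <= F x) -> uniq s -> {subset s <= X} ->
  \sum_(x <- X) F x = \sum_(x <- s) F x -> w \in X -> w \notin s -> F w = 0.
Proof.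
move=> F0 us sX eqF wX ws.
have perm_s : perm_eq [seq x <- X | x \in s] s.
  apply: uniq_perm; rewrite ?filter_uniq ?fset_uniq // => x.
  by rewrite mem_filter andb_idr // => /sX.
move: eqF; rewrite (bigID (mem s)) /= -big_filter (perm_big _ perm_s) /=.
move/eqP; rewrite -subr_eq0 addrAC subrr add0r psumr_eq0 //.
by move/allP/(_ w wX); rewrite ws /= => /eqP.
Qed.

(** Otherwise the differences [F w - c] would be nonnegative with sum zero, hence all zero, against
    [c < F x]. *)
Lemma exists_below_mean (R : realDomainType) (T : choiceType) (X : {fset T})
    (F : T -> R) c x :
  \sum_(w <- X) F w = \sum_(w <- X) c -> x \in X -> c < F x ->
  exists2 w, w \in X & F w < c.
Proof.
move=> sumF xX cx; apply/hasP/negPn/negP => /hasPn ge_c.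
have /eqP : \sum_(w <- X) (F w - c) = 0 by rewrite sumrB sumF subrr.
rewrite big_seq psumr_eq0 => [/allP/(_ x xX)|w wX].
  by rewrite xX subr_eq0 => /eqP Fx; rewrite Fx ltxx in cx.
by rewrite subr_ge0 leNgt ge_c.
Qed.

(** * Moments of the design and its inner products *)

Section Design.
Variables (R : realType) (X : {fset 'rV[R]_4}).
Hypothesis hdesign : spherical_design (mem [:: 10; 4; 2]%N) X.
Hypothesis hanti : antipodal X.
Hypothesis hcard : #|` X| = 24%N.

Lemma design_sphere x : x \in X -> inner x x = 1.
Proof. by case: hdesign => _ + _ => /[apply] /eqP. Qed.

Lemma design_opp x : x \in X -> - x \in X.
Proof. by move=> xX; rewrite -[X]hanti in_imfset. Qed.

Lemma sum_design_const (c : R) : \sum_(x <- X) c = 24%:R * c.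
Proof.
by rewrite big_const_seq count_predT iter_addr_0 -hcard mulr_natl.
Qed.

Lemma sum_zonal y n : n \in [:: 10; 4; 2]%N ->
  \sum_(x <- X) evalv (zonal y n) x = 0.
Proof. by case: hdesign => _ _ h nT; apply: (h n nT _ (zonal_harm y n)). Qed.

(** From [U_2 = 4 t^2 - 1]: four times the sum is [24 |y|^2]. *)
Lemma sum_inner_sq y : \sum_(x <- X) inner x y ^+ 2 = 6%:R * inner y y.
Proof.
have /(_ isT) := @sum_zonal y 2.
rewrite (eq_big_seq (fun x => 4%:R * inner x y ^+ 2 - inner y y)); last first.
  move=> x xX.
  by rewrite evalv_zonalSS evalv_zonal1 evalv_zonal0 (design_sphere xX); ring.
by rewrite sumrB -mulr_sumr sum_design_const; lra.
Qed.

(** From [U_4 = 16 t^4 - 12 t^2 + 1] and the second moment: [(12 * 6 - 24) / 16 = 3]. *)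
Lemma sum_inner_quartic y :
  \sum_(x <- X) inner x y ^+ 4 = 3%:R * inner y y ^+ 2.
Proof.
have /(_ isT) := @sum_zonal y 4.
rewrite (eq_big_seq (fun x => 16%:R * inner x y ^+ 4
   - 12%:R * inner y y * inner x y ^+ 2 + inner y y ^+ 2)); last first.
  move=> x xX; rewrite !evalv_zonalSS evalv_zonal1 evalv_zonal0.
  by rewrite (design_sphere xX); ring.
rewrite big_split sumrB -!mulr_sumr sum_design_const /= sum_inner_sq.
by lra.
Qed.

(** Polarization: [(a+b)^4 + (a-b)^4 = 2 a^4 + 2 b^4 + 12 a^2 b^2]. As [|x+y|^2 = |x-y|^2 = 2], the
    fourth moments give [24 = 12 + 12 S]. *)
Lemma sum_inner_sq_sq x y : inner x x = 1 -> inner y y = 1 -> inner x y = 0 ->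
  \sum_(w <- X) inner w x ^+ 2 * inner w y ^+ 2 = 1.
Proof.
move=> xx yy xy.
have := sum_inner_quartic (x + y); have := sum_inner_quartic (x - y).
have := sum_inner_quartic x; have := sum_inner_quartic y.
rewrite !innerE xx yy (innerC y) xy => qy qx qm qp.
have : \sum_(w <- X) inner w (x + y) ^+ 4 + \sum_(w <- X) inner w (x - y) ^+ 4
   = 2 * \sum_(w <- X) inner w x ^+ 4 + 2 * \sum_(w <- X) inner w y ^+ 4
     + 12%:R * \sum_(w <- X) inner w x ^+ 2 * inner w y ^+ 2.
  rewrite !mulr_sumr -!big_split; apply: eq_bigr => w _ /=.
  by rewrite !innerE; ring.
by rewrite qx qy qm qp; lra.
Qed.

Lemma unit_neq_opp x : x \in X -> x != - x.
Proof.
move=> /design_sphere xx; apply/eqP => e.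
by move: (xx); rewrite {1}e innerNl xx; lra.
Qed.

Lemma design_inner x y : x \in X -> y \in X ->
  [\/ x = y, x = - y, inner x y = 0 | inner x y ^+ 2 = 4^-1].
Proof.
move=> xX yX.
pose F (t : R) : R := 64%:R * (t ^+ 2 * (t ^+ 2 - 4^-1) ^+ 2)
                * (16%:R * t ^+ 4 - 28%:R * t ^+ 2 + 13%:R).
have pos (t : R) : 0 < 16%:R * t ^+ 4 - 28%:R * t ^+ 2 + 13%:R :> R.
  have -> : 16%:R * t ^+ 4 - 28%:R * t ^+ 2 + 13%:R
    = (4%:R * t ^+ 2 - 7%:R / 2) ^+ 2 + 3%:R / 4 :> R by field.
  by rewrite ltr_wpDl ?sqr_ge0 // divr_gt0 ?ltr0n.
have F0 t : 0 <= F t.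
  apply: mulr_ge0; last exact: ltW (pos t).
  by apply: mulr_ge0; rewrite ?ler0n //; apply: mulr_ge0; apply: sqr_ge0.
have yy := design_sphere yX.
have sumF : \sum_(w <- X) F (inner w y) = \sum_(w <- [:: y; - y]) F (inner w y).
  rewrite !big_cons big_nil innerNl yy.
  (* On unit vectors [F] is the Chebyshev combination [U_10 + 2 U_4 + 4 U_2 + 3]. *)
  transitivity (\sum_(w <- X) (evalv (zonal y 10) w + 2 * evalv (zonal y 4) w
                 + 4%:R * evalv (zonal y 2) w + 3%:R)).
    apply: eq_big_seq => w wX.
    rewrite !evalv_zonalSS evalv_zonal1 evalv_zonal0 yy (design_sphere wX).
    by rewrite /F; field.
  transitivity (\sum_(w <- X) evalv (zonal y 10) w
    + 2 * \sum_(w <- X) evalv (zonal y 4) w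
    + 4%:R * \sum_(w <- X) evalv (zonal y 2) w + \sum_(w <- X) 3%:R).
    by rewrite !mulr_sumr -!big_split.
  (* Only the constant survives: [24 * 3 = 72], which matches [F 1 + F (-1) = 36 + 36]. *)
  rewrite !sum_zonal // sum_design_const /F.
  by field.
case: (eqVneq x y) => [->|xy]; first by constructor 1.
case: (eqVneq x (- y)) => [->|xNy]; first by constructor 2.
have : F (inner x y) = 0.
  apply: (sum_gap (F := fun w => F (inner w y)) _ _ _ sumF) => //=.
  - by rewrite inE unit_neq_opp.
  - by move=> w; rewrite !inE => /orP[]/eqP-> //; apply: design_opp.
  - by rewrite !inE negb_or xy.
rewrite /F => /eqP; rewrite mulf_eq0 (gt_eqF (pos _)) orbF.
by rewrite mulf_eq0 pnatr_eq0 /= mulf_eq0 !expf_eq0 /= subr_eq0 => /orP[]/eqP; [constructor 3 | constructor 4].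
Qed.

(* [sum (<w,x>^2 - <w,y>^2)^2 = 3 + 3 - 2] is already reached on [x, -x, y, -y]. *)
Lemma design_inner_sq_eq x y w : x \in X -> y \in X -> w \in X ->
  inner x y = 0 -> w \notin [:: x; - x; y; - y] ->
  inner w x ^+ 2 = inner w y ^+ 2.
Proof.
move=> xX yX wX xy ws.
have xx := design_sphere xX; have yy := design_sphere yX.
suff /eqP : (inner w x ^+ 2 - inner w y ^+ 2) ^+ 2 = 0.
  by rewrite expf_eq0 /= subr_eq0 => /eqP.
pose F v := (inner v x ^+ 2 - inner v y ^+ 2) ^+ 2.
apply: (sum_gap (X := X) (F := F) _ _ _ _ wX ws).
- by move=> v; rewrite sqr_ge0.
- have neq u v : inner u x != inner v x -> u != v by apply: contraNneq => ->.
  rewrite /= !inE !negb_or !unit_neq_opp //.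
  have yx : inner y x = 0 by rewrite innerC.
  by rewrite !neq // ?innerNl yx xx ?oppr0 ?oppr_eq0 oner_eq0.
- move=> v; rewrite !inE => /or4P[]/eqP-> //; exact: design_opp.
transitivity (\sum_(v <- X) (inner v x ^+ 4 + inner v y ^+ 4
    - 2 * (inner v x ^+ 2 * inner v y ^+ 2))).
  by apply: eq_bigr => v _; rewrite /F; ring.
rewrite sumrB big_split -mulr_sumr /= !sum_inner_quartic sum_inner_sq_sq //.
rewrite !big_cons big_nil /F !innerNl (innerC y) xx yy xy; ring.
Qed.

End Design.

(** * An orthonormal frame inside the design *)

(** The pairing condition compares vectors, not positions, and so cannot detect repetitions; hence
    [uniq]. *)
Definition orthonormal (R : realType) (d : nat) (s : seq 'rV[R]_d) :=
  uniq s /\ {in s &, forall x y, inner x y = (x == y)%:R}.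

Section Frame.
Variables (R : realType) (X : {fset 'rV[R]_4}).
Hypothesis hdesign : spherical_design (mem [:: 10; 4; 2]%N) X.
Hypothesis hanti : antipodal X.
Hypothesis hcard : #|` X| = 24%N.

(* Some [w] in [X] has [sum_(x in s) <w,x>^2] below its mean [size s / 4]; the
   squares being all equal off [s] and [-s], they are below 1/4, hence zero. *)
Lemma extend_frame (s : seq 'rV[R]_4) : (0 < size s < 4)%N ->
  {subset s <= X} -> orthonormal s ->
  exists2 w, w \in X & {in s, forall x, inner w x = 0}.
Proof.
move=> /andP[s0 s4] sX [us os].
pose F w := \sum_(x <- s) inner w x ^+ 2.
have sumF : \sum_(w <- X) F w = \sum_(w <- X) (size s)%:R / 4.
  (* After exchanging the sums, each unit vector of [s] contributes its second moment
     [6 = 24 / 4]. *)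
  rewrite exchange_big sum_design_const //=.
  rewrite (eq_big_seq (fun=> 6%:R)).
    by rewrite big_const_seq count_predT iter_addr_0 -mulr_natr; field.
  by move=> x xs; rewrite sum_inner_sq // os // eqxx mulr1.
have Fs x : x \in s -> F x = 1.
  move=> xs; rewrite /F (bigD1_seq x) //= big_seq_cond big1; last first.
    by move=> y /andP[ys yx]; rewrite os // eq_sym (negbTE yx) expr0n.
  by rewrite os // eqxx expr1n addr0.
have size_lt : (size s)%:R / 4 < 1 :> R.
  by rewrite ltr_pdivrMr ?mul1r ?ltr_nat ?ltr0n.
have [x1 x1s] : exists x, x \in s.
  by case: (s) s0 => // x ? _; exists x; rewrite mem_head.
have [|w wX Fw] := exists_below_mean sumF (sX _ x1s); first by rewrite Fs.
exists w => // x xs.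
(* [F] is [1] on [s] and on its opposites, above the mean since [size s < 4]. *)
have ws y : y \in s -> w != y /\ w != - y.
  move=> ys; split; apply: contraTneq Fw => ->; rewrite -leNgt.
    by rewrite Fs // ltW.
  rewrite /F; under eq_bigr => z _ do rewrite innerNl sqrrN.
  by rewrite -/(F y) Fs // ltW.
have eq_sq y : y \in s -> inner w y ^+ 2 = inner w x ^+ 2.
  move=> ys; have [->//|yx] := eqVneq y x.
  apply: (design_inner_sq_eq hdesign hanti hcard) => //; try exact: sX.
    by rewrite os // (negbTE yx).
  have [wy wNy] := ws _ ys; have [wx wNx] := ws _ xs.
  by rewrite !inE !negb_or wy wNy wx wNx.
have [e|e|//|e] := design_inner hdesign hanti hcard wX (sX _ xs).
- by have [] := ws _ xs; rewrite e eqxx.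
- by have [] := ws _ xs; rewrite e eqxx.
(* If one square were [1/4], all would be, and [F w] would equal the mean. *)
move: Fw; rewrite /F (eq_big_seq _ eq_sq) e.
by rewrite big_const_seq count_predT iter_addr_0 mulr_natl ltxx.
Qed.

(** Start from any point and extend up to three times. *)
Lemma design_frame_seq n : (n < 4)%N -> exists s : seq 'rV[R]_4,
  [/\ size s = n.+1, {subset s <= X} & orthonormal s].
Proof.
elim: n => [_|n IHn n4].
  have [X0 _ _] := hdesign; have [x xX] := fset0Pn _ X0.
  exists [:: x]; split=> //; first by move=> y; rewrite inE => /eqP->.
  split=> // y z; rewrite !inE => /eqP-> /eqP->.
  by rewrite (design_sphere hdesign xX) eqxx.
have [s [sn sX os]] := IHn (ltnW n4).
have [|w wX ws] := extend_frame _ sX os; first by rewrite sn.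
have ww := design_sphere hdesign wX.
have wNs x : x \in s -> (w == x) = false.
  move=> xs; apply/eqP => wx; move: ww; rewrite {2}wx ws // => /eqP.
  by rewrite eq_sym oner_eq0.
exists (w :: s); split=> /=; first by rewrite sn.
  by move=> x; rewrite inE => /orP[/eqP->|/sX].
case: os => us os; split=> /=.
  by rewrite us andbT; apply/negP => /wNs; rewrite eqxx.
move=> x y; rewrite !inE => /orP[/eqP->|xs] /orP[/eqP->|ys].
- by rewrite ww eqxx.
- by rewrite ws // wNs.
- by rewrite innerC ws // eq_sym wNs.
- exact: os.
Qed.

Lemma design_frame : exists e : 'I_4 -> 'rV[R]_4,
  (forall i, e i \in X) /\ (forall i j, inner (e i) (e j) = (i == j)%:R).
Proof.
have [s [s4 sX [us os]]] := design_frame_seq (leqnn 4).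
exists (fun i : 'I_4 => nth 0 s i).
have es (i : 'I_4) : nth 0 s i \in s by rewrite mem_nth // s4.
by split=> [i|i j]; [apply: sX | rewrite os // nth_uniq ?s4].
Qed.

(** Comparing frame vectors two at a time by [design_inner_sq_eq]; with Parseval the common square
    will be [1/4]. *)
Lemma design_frame_inner (e : 'I_4 -> 'rV[R]_4) w :
  (forall i, e i \in X) -> (forall i j, inner (e i) (e j) = (i == j)%:R) ->
  w \in X ->
  (exists k, w = e k \/ w = - e k) \/
  (forall i j, inner w (e i) ^+ 2 = inner w (e j) ^+ 2).
Proof.
move=> eX eo wX.
have [/existsP[k /orP wk]|/existsPn wN] :=
  boolP [exists k, (w == e k) || (w == - e k)].
  by left; exists k; case: wk => /eqP; [left | right].
right=> i j; have [->//|ij] := eqVneq i j.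
apply: (design_inner_sq_eq hdesign hanti hcard) => //.
  by rewrite eo (negbTE ij).
by rewrite !inE orbA negb_or !wN.
Qed.

End Frame.

(** * Membership in D_4 and its size *)

Section D4Coordinates.
Variable R : realType.
Implicit Types u : 'rV[R]_4.

Lemma sign_of_sqr1 (c : R) : c ^+ 2 = 1 -> exists a : bool, c = (-1) ^+ a.
Proof.
move/eqP; rewrite sqrf_eq1 => /orP[]/eqP->; first by exists false.
by exists true.
Qed.

(** A criterion by support and squares, so that later proofs need not exhibit permutations. *)
Lemma mem_D4 u (i j : 'I_4) : i != j -> u 0 i ^+ 2 = 1 -> u 0 j ^+ 2 = 1 ->
  (forall k, k != i -> k != j -> u 0 k = 0) -> u \in D4 R.
Proof.
move=> ij /sign_of_sqr1[a ua] /sign_of_sqr1[b ub] u0.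
pose o1 : 'I_4 := inord 1.
have v1 : o1 = 1%N :> nat by rewrite inordK.
have o01 : ord0 != o1 by rewrite -val_eqE /= v1.
(* The first transposition sends [i] to 0 and [j] to [j']; the second sends [j'] to 1 and leaves 0
   fixed. *)
pose j' := tperm i ord0 j.
have j'0 : j' != ord0.
  by rewrite /j' -{2}(tpermL i ord0) (inj_eq perm_inj) eq_sym.
pose s : {perm 'I_4} := (tperm i ord0 * tperm j' o1)%g.
have si : s i = ord0 by rewrite permM tpermL tpermD // eq_sym.
have sj : s j = o1 by rewrite permM -/j' tpermL.
apply/imfsetP; exists (s, (a, b)) => //=.
apply/rowP => k; rewrite !mxE /=.
have [->|ki] := eqVneq k i; first by rewrite si ua.
have [->|kj] := eqVneq k j; first by rewrite sj v1 ub.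
rewrite u0 //.
have : s k != ord0 by rewrite -si (inj_eq perm_inj).
have : s k != o1 by rewrite -sj (inj_eq perm_inj).
by rewrite -!val_eqE /= v1; case: (s k) => [[|[|[|[|]]]]].
Qed.

Definition D4_vec (p : nat * nat) (c : bool * bool) : 'rV[R]_4 :=
  \row_k (if k == p.1 :> nat then (-1) ^+ c.1
          else if k == p.2 :> nat then (-1) ^+ c.2 else 0).

(** Six pairs of positions times four pairs of signs. The upper bound is what turns an inclusion of
    the 24-point set [X] into an equality. *)
Lemma card_D4_le : (#|` D4 R| <= 24)%N.
Proof.
pose ps : seq (nat * nat) :=
  [:: (0, 1); (0, 2); (0, 3); (1, 2); (1, 3); (2, 3)]%N.
pose cs := [:: (false, false); (false, true); (true, false); (true, true)].
have := @uniq_leq_size _ (D4 R) [seq D4_vec p c | p <- ps, c <- cs].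
apply; first exact: fset_uniq.
have cP c : c \in cs by case: c => [[] []].
have psP (i j : 'I_4) : (i < j)%N -> (val i, val j) \in ps.
  by case: i => [[|[|[|[|]]]]] //; case: j => [[|[|[|[|]]]]].
move=> u /imfsetP[[s [a b]] _ /= ->].
pose o1 : 'I_4 := inord 1.
have v1 : o1 = 1%N :> nat by rewrite inordK.
(* The positions to which [s] carries the two nonzero entries. *)
pose i := (s^-1)%g ord0; pose j := (s^-1)%g o1.
have ij : i != j by rewrite (inj_eq perm_inj) -val_eqE /= v1.
have uE k : col_perm s (D4_base R a b) 0 k =
    if k == i then (-1) ^+ a else if k == j then (-1) ^+ b else 0.
  rewrite !mxE /= -(can2_eq (permK s) (permKV s)).
  rewrite -(can2_eq (permK s) (permKV s)) -!val_eqE /= v1.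
  by case: (s k) => [[|[|[|[|]]]]].
case: (ltngtP i j) => [lt_ij|lt_ji|/val_inj eq_ij]; last first.
- by rewrite eq_ij eqxx in ij.
(* Listing the positions in increasing order swaps the signs as well. *)
- have -> : col_perm s (D4_base R a b) = D4_vec (val j, val i) (b, a).
    apply/rowP => k; rewrite uE mxE /= !val_eqE.
    by case: (eqVneq k i) => [->|//]; rewrite (negbTE ij).
  exact: (allpairs_f (@D4_vec) (psP _ _ lt_ji) (cP (b, a))).
have -> : col_perm s (D4_base R a b) = D4_vec (val i, val j) (a, b).
  by apply/rowP => k; rewrite uE mxE /= !val_eqE.
exact: (allpairs_f (@D4_vec) (psP _ _ lt_ij) (cP (a, b))).
Qed.

Lemma card_scaled_D4_le : (#|` scaled_D4 R| <= 24)%N.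
Proof. by apply: leq_trans card_D4_le; apply: leq_imfset_card. Qed.

End D4Coordinates.

(* Adjacent pairs of the frame are rotated by 45 degrees, which turns the
   vectors [+-e_i], [(+-e_1 +- e_2 +- e_3 +- e_4) / 2] into [D_4 / sqrt 2]. *)
Definition rot45 (V : zmodType) (e : 'I_4 -> V) (i : nat) : V :=
  let o k : 'I_4 := inord k in
  nth 0 [:: e (o 0%N) + e (o 1%N); e (o 0%N) - e (o 1%N);
            e (o 2%N) + e (o 3%N); e (o 2%N) - e (o 3%N)] i.

Lemma sqr_invsqrt2 (R : realType) : (Num.sqrt 2 : R)^-1 ^+ 2 = 2^-1.
Proof. by rewrite exprVn sqr_sqrtr ?ler0n. Qed.

(** Indices appear as [inord], the form used inside [rot45]. *)
Lemma forall_I4 (P : 'I_4 -> Prop) : P (inord 0) -> P (inord 1) ->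
  P (inord 2) -> P (inord 3) -> forall i, P i.
Proof.
move=> P0 P1 P2 P3 i; rewrite -[i]inord_val.
by case: i => [[|[|[|[|]]]]].
Qed.

(** * The rotated frame as an orthogonal change of coordinates *)

Section Rot45.
Variables (R : realType) (e : 'I_4 -> 'rV[R]_4).
Hypothesis eo : forall i j, inner (e i) (e j) = (i == j)%:R.

Definition rot45_mx : 'M[R]_4 := \matrix_(i < 4) ((Num.sqrt 2)^-1 *: rot45 e i).

Lemma rot45_mx_orth : rot45_mx *m rot45_mx^T = 1%:M.
Proof.
have rr : (Num.sqrt 2 : R)^-1 * (Num.sqrt 2)^-1 = 2^-1 by apply: sqr_invsqrt2.
apply/matrixP => i j; transitivity (inner (row i rot45_mx) (row j rot45_mx)).
  by rewrite mxE; apply: eq_bigr => k _; rewrite !mxE.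
rewrite !rowK innerZl innerZr mulrA rr !mxE.
elim/forall_I4: i; elim/forall_I4: j; rewrite /rot45 !inordK //= !innerE !eo;
  rewrite -!val_eqE /= !inordK //=; lra.
Qed.

(** Expansion of [w] in the orthonormal rows of [rot45_mx]. Since [rot45] is linear in the frame,
    the coefficients are [rot45] of the frame coordinates of [w]. *)
Lemma rot45_coord w :
  w = ((Num.sqrt 2)^-1 *: \row_i rot45 (fun k => inner w (e k)) i) *m rot45_mx.
Proof.
rewrite -[LHS]mulmx1 -(mulmx1C rot45_mx_orth) mulmxA; congr (_ *m _).
apply/rowP => i; transitivity (inner w (row i rot45_mx)).
  by rewrite mxE; apply: eq_bigr => k _; rewrite !mxE.
rewrite rowK innerZr !mxE; congr (_ * _).
by elim/forall_I4: i; rewrite /rot45 !inordK //= !innerE.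
Qed.

Lemma inner_rot45_mx x y : inner (x *m rot45_mx) (y *m rot45_mx) = inner x y.
Proof.
by rewrite !inner_mulmx trmx_mul mulmxA -(mulmxA x) rot45_mx_orth mulmx1.
Qed.

Lemma sum_I4 (F : 'I_4 -> R) :
  \sum_i F i = F (inord 0) + F (inord 1) + F (inord 2) + F (inord 3).
Proof.
rewrite !big_ord_recr big_ord0 /= add0r.
by congr (F _ + F _ + F _ + F _); apply: val_inj; rewrite /= inordK.
Qed.

(** The matrix preserves norms, and [(a+b)^2 + (a-b)^2 = 2 (a^2 + b^2)] in each plane cancels the
    factor [1/2]. *)
Lemma parseval w : \sum_i inner w (e i) ^+ 2 = inner w w.
Proof.
rewrite [in RHS](rot45_coord w) inner_rot45_mx innerZl innerZr mulrA -expr2.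
rewrite sqr_invsqrt2 /inner [in RHS]sum_I4 !mxE sum_I4 /rot45 !inordK //=.
by field.
Qed.

End Rot45.

(** Sum and difference are both [1] or [-1] in the coordinate plane containing [k], and both vanish
    in the other plane. *)
Lemma rot45_axis_D4 (R : realType) (a : 'I_4 -> R) (k : 'I_4) :
  a k ^+ 2 = 1 -> (forall i, i != k -> a i = 0) ->
  \row_i rot45 a i \in D4 R.
Proof.
have neq i j : (i < 4)%N -> (j < 4)%N -> i != j -> inord i != inord j :> 'I_4.
  by move=> i4 j4; rewrite -val_eqE /= !inordK.
elim/forall_I4: k => ak a0;
  [ move: (a0 (inord 1) (neq 1 0 isT isT isT)%N)
      (a0 (inord 2) (neq 2 0 isT isT isT)%N)
      (a0 (inord 3) (neq 3 0 isT isT isT)%N) => z1 z2 z3;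
    apply: (@mem_D4 _ _ (inord 0) (inord 1))
  | move: (a0 (inord 0) (neq 0 1 isT isT isT)%N)
      (a0 (inord 2) (neq 2 1 isT isT isT)%N)
      (a0 (inord 3) (neq 3 1 isT isT isT)%N) => z1 z2 z3;
    apply: (@mem_D4 _ _ (inord 0) (inord 1))
  | move: (a0 (inord 0) (neq 0 2 isT isT isT)%N)
      (a0 (inord 1) (neq 1 2 isT isT isT)%N)
      (a0 (inord 3) (neq 3 2 isT isT isT)%N) => z1 z2 z3;
    apply: (@mem_D4 _ _ (inord 2) (inord 3))
  | move: (a0 (inord 0) (neq 0 3 isT isT isT)%N)
      (a0 (inord 1) (neq 1 3 isT isT isT)%N)
      (a0 (inord 2) (neq 2 3 isT isT isT)%N) => z1 z2 z3;
    apply: (@mem_D4 _ _ (inord 2) (inord 3)) ];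
  rewrite ?neq //; try (elim/forall_I4; rewrite ?eqxx // => _ _);
  by rewrite mxE /rot45 inordK //= ?(z1, z2, z3)
    ?addr0 ?subr0 ?sub0r ?add0r ?sqrrN ?oppr0.
Qed.

(** In each of the two planes the entries are equal or opposite, so exactly one of their sum and
    difference vanishes and the other is [1] or [-1]. *)
Lemma rot45_half_D4 (R : realType) (a : 'I_4 -> R) :
  (forall i, a i ^+ 2 = 4^-1) -> \row_i rot45 a i \in D4 R.
Proof.
move=> aq.
have neq i j : (i < 4)%N -> (j < 4)%N -> i != j -> inord i != inord j :> 'I_4.
  by move=> i4 j4; rewrite -val_eqE /= !inordK.
have sgn i j : a i = a j \/ a i = - a j.
  have /eqP : a i ^+ 2 = a j ^+ 2 by rewrite !aq.
  by rewrite eqf_sqr => /orP[]/eqP; [left | right].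
have dbl i : (a i + a i) ^+ 2 = 1.
  by rewrite -mulr2n -mulr_natl exprMn aq; field.
case: (sgn (inord 1) (inord 0)) => e1; case: (sgn (inord 3) (inord 2)) => e3;
  [ apply: (@mem_D4 _ _ (inord 0) (inord 2))
  | apply: (@mem_D4 _ _ (inord 0) (inord 3))
  | apply: (@mem_D4 _ _ (inord 1) (inord 2))
  | apply: (@mem_D4 _ _ (inord 1) (inord 3)) ]; rewrite ?neq //;
  try (elim/forall_I4; rewrite ?eqxx // => _ _);
  by rewrite mxE /rot45 inordK //= ?e1 ?e3 ?opprK ?subrr.
Qed.

(** * Identification of the design with the rotated root system *)

Local Open Scope fset_scope.

Theorem theorem5p1 (R : realType) (X : {fset 'rV[R]_4})
    (hdesign : spherical_design (mem [:: 10; 4; 2]%N) X)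
    (hanti : antipodal X)
    (hcard : #|` X| = 24%N) :
  exists s : {linear 'rV[R]_4 -> 'rV[R]_4},
    orthogonal_map s /\ X = [fset s x | x in scaled_D4 R].
Proof.
have [e [eX eo]] := design_frame hdesign hanti hcard.
exists (mulmxr (rot45_mx e)); split; first exact: inner_rot45_mx.
(* The image has at most 24 points, so it is enough that it contains [X]. *)
apply/eqP; rewrite eqEfcard hcard; apply/andP; split; last first.
  by apply: leq_trans (card_scaled_D4_le R); apply: leq_imfset_card.
apply/fsubsetP => w wX; apply/imfsetP.
exists ((Num.sqrt 2)^-1 *: \row_i rot45 (fun k => inner w (e k)) i);
  last exact: rot45_coord.
rewrite /= in_imfset //=.
have [[k wk]|wsq] := design_frame_inner hdesign hanti hcard eX eo wX.
  apply: (@rot45_axis_D4 _ _ k).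
    by case: wk => ->; rewrite ?innerNl ?sqrrN eo eqxx expr1n.
  move=> i ik.
  by case: wk => ->; rewrite ?innerNl eo eq_sym (negbTE ik) ?oppr0.
apply: rot45_half_D4 => i.
(* Four equal squares with sum [1] are each [1/4]. *)
have := parseval eo w; rewrite (eq_bigr _ (fun j _ => wsq j i)).
by rewrite sumr_const card_ord (design_sphere hdesign wX) -mulr_natl; lra.
Qed.
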